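(* Let $r\geq 1$ be an integer and let $D$ be either $D=1$ or a prime number $D\geq 2$. Then there exists a sequence of integers $\underline{\alpha}:\ \alpha_1<\alpha_2<\cdots<\alpha_{rD}$ with $\alpha_1\geq 2$ such that $\Delta_{r,D}(\underline{\alpha})\neq 0$.
   Context: $B_n(x)$ denotes the $n$-th Bernoulli polynomial, defined by $\frac{ze^{xz}}{e^z-1}=\sum_{n\ge 0}B_n(x)\frac{z^n}{n!}$. For integers $r,D\geq 1$ and integers $\alpha_1<\cdots<\alpha_{rD}$ with $\alpha_1\ge 2$, $\Delta_{r,D}(\underline{\alpha})$ is the determinant of the $rD\times rD$ matrix whose entry in row $j$ ($1\le j\le rD$) and column $mD+v$ ($0\le m\le r-1$, $1\le v\le D$) is $\dfrac{D^{\alpha_j}B_{\alpha_j+m}(v/D)}{\alpha_j+m}$. *)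

(* Defs.v *)
From mathcomp Require Import all_boot all_order all_algebra.
Set Implicit Arguments. Unset Strict Implicit. Unset Printing Implicit Defensive.
Import Order.TTheory GRing.Theory Num.Theory.
Local Open Scope ring_scope.

(* Bernoulli numbers B_0, ..., B_n (with B_1 = -1/2, the convention of
   z/(e^z-1) = sum B_n z^n/n!), computed by the recurrence
   B_n = -1/(n+1) * sum_{k<n} C(n+1,k) B_k. *)
Fixpoint bern_list (n : nat) : seq rat :=
  match n with
  | 0%N => [:: 1]
  | n'.+1 =>
      let l := bern_list n' in
      rcons l (- (n'.+2%:R)^-1 *
                 \sum_(k < n'.+1) ('C(n'.+2, k))%:R * nth 0 l k)
  end.

Definition bernoulli (n : nat) : rat := nth 0 (bern_list n) n.

(* Bernoulli polynomial B_n(x) = sum_k C(n,k) B_k x^(n-k),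
   i.e. z e^{xz}/(e^z-1) = sum_n B_n(x) z^n/n!. *)
Definition bernoulli_poly (n : nat) (x : rat) : rat :=
  \sum_(k < n.+1) ('C(n, k))%:R * bernoulli k * x ^+ (n - k).

(* The rD x rD matrix: row j (0-based, corresponding to alpha_{j+1}),
   column c = m*D + (v-1) (0-based), with 0 <= m < r, 1 <= v <= D:
   entry D^{alpha_j} B_{alpha_j + m}(v/D) / (alpha_j + m). *)
Definition Delta_matrix (r D : nat) (alpha : 'I_(r * D) -> nat) : 'M[rat]_(r * D) :=
  \matrix_(j < r * D, c < r * D)
    let m := (c %/ D)%N in
    let v := (c %% D).+1 in
    (D%:R ^+ alpha j * bernoulli_poly (alpha j + m) (v%:R / D%:R))
      / (alpha j + m)%:R.

Arguments Delta_matrix : clear implicits.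
Definition Delta (r D : nat) (alpha : 'I_(r * D) -> nat) : rat :=
  \det (Delta_matrix r D alpha).
Arguments Delta : clear implicits.

(* Main.v *)
(* With [h_v(z) = sum_n D^(n+1) B_(n+1)(v/D)/(n+1) z^n/n!], a linear relation
   between the columns, valid for all large alpha, says that a combination of
   the derivatives [h_v^(m)] is a polynomial in [z]. Since
   [h_v = D e^(v z)/(e^(D z) - 1) - 1/z] and [e^z] is transcendental over
   [Q(z)], this is an identity of rational functions in [z] and [w = e^z].
   Now [h_v^(m)] has a pole of order [m + 1] along [w^D = 1], with leading
   coefficient a nonzero multiple of [w^v], and the [w^v] for [1 <= v <= D] are
   independent modulo [w^D - 1]; so the relation is trivial. Hence the columns
   stay independent on the rows beyond any bound, and [r D] independent rows can
   be chosen one after the other, with increasing alpha. *)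
Require Import Defs.
From mathcomp Require Import all_boot all_order all_algebra.
From mathcomp Require Import ring.
From Stdlib Require Import Classical_Prop.
Set Implicit Arguments. Unset Strict Implicit. Unset Printing Implicit Defensive.
Import Order.TTheory GRing.Theory Num.Theory.
Local Open Scope ring_scope.

(** * Congruences modulo powers of ['X] *)

(** Power series in [z] are handled as polynomials known modulo ['X^N], for every [N]. *)
Lemma dvdXnP (F : fieldType) N (p : {poly F}) :
  reflect (forall i, (i < N)%N -> p`_i = 0) ('X^N %| p).
Proof.
apply: (iffP idP) => [/dvdpP[q ->] i iN|p0]; first by rewrite coefMXn iN.
apply/dvdpP; exists (drop_poly N p).
rewrite -[LHS](poly_take_drop N p) [X in X + _](_ : _ = 0) ?add0r//.
by apply/polyP => i; rewrite coef_take_poly coef0; case: ifP => // /p0.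
Qed.

Lemma dvdXn_deriv (F : fieldType) N (p : {poly F}) :
  'X^(N.+1) %| p -> 'X^N %| p^`().
Proof.
by move=> /dvdXnP p0; apply/dvdXnP => i iN; rewrite coef_deriv p0 ?mul0rn.
Qed.

Lemma dvdp_horner_sub (F : fieldType) (P : {poly {poly F}}) (a b : {poly F}) :
  a - b %| P.[a] - P.[b].
Proof.
have /factor_theorem[q Pq] : root (P - P.[b]%:P) b.
  by rewrite /root !hornerE subrr.
have := congr1 (horner^~ a) Pq; rewrite !hornerE => ->.
exact: dvdp_mull.
Qed.

(** Chain rule: the inner variable is differentiated coefficientwise, the outer one through [q]. *)
Lemma deriv_horner (F : fieldType) (P : {poly {poly F}}) (q : {poly F}) :
  P.[q]^`() = (map_poly (@deriv F) P).[q] + P^`().[q] * q^`().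
Proof.
elim/poly_ind: P => [|P c IH].
  by rewrite deriv0 map_poly0 !horner0 deriv0; ring.
have -> : map_poly (@deriv F) (P * 'X + c%:P)
          = map_poly (@deriv F) P * 'X + (c^`())%:P.
  apply/polyP => i; rewrite coef_map_id0 ?deriv0// !coefD !coefMX !coefC.
  by rewrite coef_map_id0 ?deriv0//; case: eqP; rewrite derivD ?deriv0.
rewrite !hornerE derivD derivM IH derivD derivM derivX derivC !hornerE.
ring.
Qed.

(* Polynomials in [w] (outer) over [z] (inner) stand for exponential
   polynomials [P(z, e^z)]; [dexp] is [d/dz] with [dw/dz = w]. *)
Definition dexp (P : {poly {poly rat}}) : {poly {poly rat}} :=
  map_poly (@deriv rat) P + 'X * P^`().

Lemma coef_dexp P j : (dexp P)`_j = (P`_j)^`() + P`_j *+ j.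
Proof.
by rewrite coefD coef_map_id0 ?deriv0// coefXM coef_deriv; case: j => //=.
Qed.

(** * Truncated exponential generating functions *)

Definition egf N (u : nat -> rat) : {poly rat} := \poly_(i < N) (u i / i`!%:R).

Lemma coef_egf N u n : (n < N)%N -> (egf N u)`_n = u n / n`!%:R.
Proof. by move=> nN; rewrite coef_poly nN. Qed.

Lemma coef_egfM N u w n : (n < N)%N ->
  (egf N u * egf N w)`_n =
  (\sum_(k < n.+1) 'C(n, k)%:R * u k * w (n - k)%N) / n`!%:R.
Proof.
move=> nN; rewrite coefM mulr_suml; apply: eq_bigr => k _.
have kn : (k <= n)%N by rewrite -ltnS.
rewrite !coef_egf ?(leq_ltn_trans kn) ?(leq_ltn_trans (leq_subr _ _))//.
rewrite -(bin_fact kn) !natrM; field.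
by rewrite !pnatr_eq0 -!lt0n !fact_gt0 bin_gt0.
Qed.

(** Differentiation costs one order of precision, hence the [N.+1] here and in what follows. *)
Lemma deriv_egf N u : (egf N.+1 u)^`() = egf N (fun n => u n.+1).
Proof.
apply/polyP => i; rewrite coef_deriv !coef_poly ltnS.
case: ifP => _; rewrite ?mul0rn// factS natrM -[LHS]mulr_natr invfM.
by rewrite mulrCA mulrC mulVKf ?pnatr_eq0.
Qed.

Lemma egfS N u : 'X^N %| egf N.+1 u - egf N u.
Proof.
by apply/dvdXnP => i iN; rewrite coefB !coef_poly iN leqW// subrr.
Qed.

(** * Evaluation at [w = e^z] and transcendence of [e^z] *)

Definition exp_trunc N : {poly rat} := egf N (fun=> 1).

(** This is [P(z, e^z)] with [e^z] truncated; only its residue modulo ['X^N] is meaningful. *)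
Definition ev N (P : {poly {poly rat}}) : {poly rat} := P.[exp_trunc N].

Lemma evM N P Q : ev N (P * Q) = ev N P * ev N Q.
Proof. exact: hornerM. Qed.
Lemma evB N P Q : ev N (P - Q) = ev N P - ev N Q.
Proof. by rewrite /ev hornerD hornerN. Qed.
Lemma evX N P n : ev N (P ^+ n) = ev N P ^+ n. Proof. exact: horner_exp. Qed.
Lemma evC N c : ev N c%:P = c. Proof. exact: hornerC. Qed.

Lemma evS N P : 'X^N %| ev N.+1 P - ev N P.
Proof. exact: dvdp_trans (egfS N _) (dvdp_horner_sub _ _ _). Qed.

Lemma deriv_ev N P : 'X^N %| (ev N.+1 P)^`() - ev N (dexp P).
Proof.
rewrite /ev deriv_horner deriv_egf hornerD hornerM hornerX -!/(ev _ _).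
set a := ev N.+1 _; set b := ev N.+1 _.
set a' := ev N _; set b' := ev N _; set e := exp_trunc N.
have -> : a + b * e - (a' + e * b') = (a - a') + e * (b - b') by ring.
by rewrite dvdp_add ?dvdp_mull ?evS.
Qed.

(* Transcendence of [e^z] over [Q(z)]. If [P] has [w]-degree [J], then
   [dexp P - J P] vanishes at [e^z] too, and it is smaller since its
   coefficient of [w^J] is the derivative of that of [P]. *)
Lemma ev_inj P : (forall N, 'X^N %| ev N P) -> P = 0.
Proof.
move: {2}(size P) (leqnn (size P)) => J; elim: J P => [P|J IHJ P].
  by rewrite leqn0 size_poly_eq0 => /eqP.
have [k] := ubnP (size P`_J); elim: k P => // k IHk P lek sP P0.
have [PJ0|PJ_neq0] := eqVneq P`_J 0.
  apply: IHJ => //; apply/leq_sizeP => j; rewrite leq_eqVlt.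
  by case/predU1P => [<-//|Jj]; rewrite nth_default// (leq_trans sP).
pose P' := dexp P - P *+ J.
have cP' j : P'`_j = (P`_j)^`() + P`_j *+ j - P`_j *+ J.
  by rewrite coefB coefMn coef_dexp.
have P'0 : P' = 0.
  apply: IHk.
  - by rewrite cP' addrK -ltnS (leq_trans _ lek)// !ltnS lt_size_deriv.
  - apply/leq_sizeP => j Jj.
    by rewrite cP' nth_default ?(leq_trans sP)// deriv0 !mul0rn addr0 subr0.
  move=> N; rewrite /P' evB /ev hornerMn -!/(ev _ _).
  set u := ev N.+1 P.
  have -> : ev N (dexp P) - ev N P *+ J
          = u^`() - (u^`() - ev N (dexp P)) - J%:R * ev N P by ring.
  apply: dvdp_sub; last exact: dvdp_mull.
  by apply: dvdp_sub; [exact: dvdXn_deriv|exact: deriv_ev].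
(* For [j < J] the coefficient [p] of [w^j] satisfies [p' = (J - j) p], which forces [p = 0] by
   degree. *)
have Pj0 j : (j < J)%N -> P`_j = 0.
  move=> jJ; apply/eqP; apply/negPn/negP => Pj; have := lt_size_deriv Pj.
  have /eqP := cP' j; rewrite P'0 coef0 eq_sym -addrA -opprB subr_eq0.
  rewrite -mulrnBr ?(ltnW jJ)// => /eqP ->.
  rewrite -scaler_nat size_scale ?ltnn// pnatr_eq0 -lt0n subn_gt0//.
have defP : P = P`_J *: 'X^J.
  apply/polyP => j; rewrite coefZ coefXn.
  case: (ltngtP j J) => [/Pj0->|Jj|->]; rewrite ?mulr0 ?mulr1//.
  by rewrite nth_default// (leq_trans sP).
(* For [j = J] the same equation says that the derivative is zero; the remaining constant is read
   off at [z = 0], that is, from [N = 1]. *)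
have PJc : P`_J = (P`_J`_0)%:P.
  apply: size1_polyC; have /eqP := cP' J.
  rewrite P'0 coef0 addrK eq_sym => /eqP/polyP PJ'.
  apply/leq_sizeP => -[//|i] _; have /eqP := PJ' i.
  by rewrite coef_deriv coef0 mulrn_eq0 => /eqP.
move: PJ_neq0; have := P0 1%N.
rewrite {1}defP /ev !hornerE.
have -> : exp_trunc 1 = 1.
  by apply/polyP => i; rewrite coef_poly coef1; case: i.
rewrite expr1n mulr1 => /dvdXnP/(_ 0%N isT) PJ0.
by rewrite PJc PJ0 eqxx.
Qed.

(** * Bernoulli numbers and the values [hurw] *)

Lemma size_bern_list n : size (bern_list n) = n.+1.
Proof. by elim: n => //= n IH; rewrite size_rcons IH. Qed.

Lemma nth_bern_list n k : (k <= n)%N -> nth 0 (bern_list n) k = bernoulli k.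
Proof.
elim: n => [|n IH]; first by rewrite leqn0 => /eqP ->.
rewrite leq_eqVlt => /predU1P[->//|kn].
by rewrite /= nth_rcons size_bern_list kn IH.
Qed.

Lemma bernoulliS n : bernoulli n.+1 =
  - n.+2%:R^-1 * \sum_(k < n.+1) 'C(n.+2, k)%:R * bernoulli k.
Proof.
rewrite /bernoulli /= nth_rcons size_bern_list ltnn eqxx; congr (_ * _).
by apply: eq_bigr => k _; rewrite nth_bern_list// -ltnS.
Qed.

(** Coefficientwise form of [(e^z - 1) * sum_n B_n z^n/n! = z]. *)
Lemma bernoulli_sum n :
  \sum_(k < n) 'C(n, k)%:R * bernoulli k = (n == 1%N)%:R.
Proof.
case: n => [|[|n]]; first by rewrite big_ord0.
  by rewrite big_ord_recl big_ord0 bin0 mul1r addr0.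
rewrite big_ord_recr /= bernoulliS -addn1 binSn.
by rewrite mulrA mulrN mulfV ?pnatr_eq0// mulN1r addrN.
Qed.

Lemma bernoulli_poly0 x : bernoulli_poly 0 x = 1.
Proof. by rewrite /bernoulli_poly big_ord_recl big_ord0 bin0 !mul1r addr0. Qed.

(* Up to the column factor [D ^ m], [hurw D v (alpha + m - 1)] is an entry of
   the matrix: a Hurwitz zeta value at [1 - alpha - m], up to scaling. *)
Definition hurw D v n : rat :=
  D%:R ^+ n.+1 * bernoulli_poly n.+1 (v%:R / D%:R) / n.+1%:R.

Lemma egf_expn N v : 'X^N %| exp_trunc N ^+ v - egf N (fun n => v%:R ^+ n).
Proof.
elim: v => [|v IH].
  apply/dvdXnP => i iN; rewrite coefB coef_egf// expr0 coef1.
  by case: i {iN} => [|i]; rewrite ?expr0 ?divr1 ?exprS ?mul0r ?subrr.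
have -> : exp_trunc N ^+ v.+1 - egf N (fun n => v.+1%:R ^+ n)
  = exp_trunc N * (exp_trunc N ^+ v - egf N (fun n => v%:R ^+ n))
  + (exp_trunc N * egf N (fun n => v%:R ^+ n) - egf N (fun n => v.+1%:R ^+ n)).
  by rewrite exprS; ring.
apply: dvdp_add; first exact: dvdp_mull.
apply/dvdXnP => i iN; rewrite coefB coef_egfM// coef_egf//.
apply/eqP; rewrite subr_eq0; apply/eqP; congr (_ / _).
rewrite -natr1 exprDn; apply: eq_bigr => k _.
by rewrite expr1n !mulr1 mulr_natl.
Qed.

(** * The functions [h_v], their derivatives and their poles *)

Section Hurwitz.
Variable D : nat.
Hypothesis D0 : (0 < D)%N.

Let D_neq0 : D%:R != 0 :> rat. Proof. by rewrite pnatr_eq0 -lt0n. Qed.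

Lemma egf_hurw N v : 'X^N %| (exp_trunc N ^+ D - 1) * ('X * egf N (hurw D v))
   - (D%:R * 'X * exp_trunc N ^+ v - (exp_trunc N ^+ D - 1)).
Proof.
set e := exp_trunc N; set h := egf N _.
(* In the limit, [b = D z / (e^(D z) - 1)], [g = b e^(v z)] and [z h = g - 1]; these are [bE], [gb]
   and [hg]. *)
pose g := egf N (fun n => D%:R ^+ n * bernoulli_poly n (v%:R / D%:R)).
pose b := egf N (fun n => D%:R ^+ n * bernoulli n).
pose E x := egf N (fun n => x%:R ^+ n).
have hg : 'X^N %| 'X * h - (g - 1).
  apply/dvdXnP => i iN; rewrite !coefB coefXM coef1 (coef_egf _ iN).
  case: i iN => [|i] iN /=.
    by rewrite bernoulli_poly0 fact0 expr0 !mul1r !subrr.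
  rewrite coef_egf 1?ltnW// /hurw factS natrM; field.
  by rewrite nat1r !pnatr_eq0 -lt0n fact_gt0.
have gb : 'X^N %| g - b * E v.
  apply/dvdXnP => i iN; rewrite coefB coef_egfM// coef_egf// -mulrBl.
  rewrite /bernoulli_poly mulr_sumr -sumrB big1 ?mul0r// => k _.
  have ki : (k <= i)%N by rewrite -ltnS.
  rewrite -{1}(subnKC ki) exprD expr_div_n; field.
  by rewrite expf_neq0.
have bE : 'X^N %| (E D - 1) * b - D%:R * 'X.
  apply/dvdXnP => i iN; rewrite coefB mulrC mulrBr mulr1 coefB.
  rewrite coef_egfM// coef_egf// big_ord_recr /= subnn binn.
  rewrite expr0 mul1r mulr1 mulrDl addrK.
  have -> : \sum_(k < i)
      'C(i, k)%:R * (D%:R ^+ k * bernoulli k) * D%:R ^+ (i - k)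
      = D%:R ^+ i * (i == 1%N)%:R.
    rewrite -bernoulli_sum mulr_sumr; apply: eq_bigr => k _.
    have -> : D%:R ^+ i = D%:R ^+ k * D%:R ^+ (i - k) :> rat.
      by rewrite -exprD subnKC// ltnW.
    by ring.
  rewrite mulr_natl coefMn coefX.
  case: eqP => [->|_] /=; rewrite ?mulr0 ?mul0r ?mul0rn ?subrr//.
  by rewrite expr1 mulr1 divr1 subrr.
have -> : (e ^+ D - 1) * ('X * h) - (D%:R * 'X * e ^+ v - (e ^+ D - 1))
  = (e ^+ D - 1) * ('X * h - (g - 1)) + (e ^+ D - 1) * (g - b * E v)
    + (b * E v) * (e ^+ D - E D) + E v * ((E D - 1) * b - D%:R * 'X)
    - (D%:R * 'X) * (e ^+ v - E v) by ring.
apply: dvdp_sub; last exact/dvdp_mull/egf_expn.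
by do ?apply: dvdp_add; apply: dvdp_mull => //; exact: egf_expn.
Qed.

(** The denominator [z (w^D - 1)] of [h_v]. *)
Let S : {poly {poly rat}} := 'X%:P * ('X^D - 1).

(** Written so as to show the residue [D z] modulo [w^D - 1]. *)
Lemma dexp_S : dexp S = ('X^D - 1) * (1 + D%:R * 'X%:P) + D%:R * 'X%:P.
Proof.
have -> : ('X^D - 1) * (1 + D%:R * 'X%:P) + D%:R * 'X%:P
        = 'X^D - 1 + (D%:R * 'X)%:P * 'X^D :> {poly {poly rat}}.
  by rewrite rmorphM rmorph_nat; ring.
apply/polyP => j.
rewrite coef_dexp !(coefD, coefN, coefCM, coefXn, coef1) -mulr_natl.
case: (eqVneq j D) => [->|_]; rewrite ?(gtn_eqF D0) /=.
  by rewrite -polyC_natr !derivE; ring.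
by case: (eqVneq j 0%N) => [->|_]; rewrite ?mulr0n -?polyC_natr ?derivE; ring.
Qed.

(* [polar m v / S ^ (m + 1)] is the [m]-th derivative of [h_v]. *)
Fixpoint polar m v : {poly {poly rat}} :=
  if m is m'.+1 then S * dexp (polar m' v) - m'.+1%:R * dexp S * polar m' v
  else D%:R * 'X%:P * 'X^v - ('X^D - 1).

Lemma ev_S N : ev N S = 'X * (exp_trunc N ^+ D - 1).
Proof. by rewrite evM evC evB evX /ev hornerX hornerC. Qed.

(** Differentiating [S^(m+1) h^(m) = polar m v] and multiplying by [S] gives the recurrence that
    defines [polar]. *)
Lemma polarP m v N : 'X^N %|
  ev N S ^+ m.+1 * egf N (fun n => hurw D v (n + m)) - ev N (polar m v).
Proof.
elim: m N => [|m IH] N.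
  rewrite ev_S /= evB !evM evC evB !evX /ev hornerX !hornerC.
  rewrite -polyC_natr hornerC.
  rewrite (_ : egf _ _ = egf N (hurw D v)); last first.
    by apply/polyP => i; rewrite !coef_poly addn0.
  by rewrite expr1 -mulrA mulrCA egf_hurw.
have /dvdXn_deriv := IH N.+1.
rewrite derivB derivM deriv_exp deriv_egf.
rewrite (_ : egf N _ = egf N (fun n => hurw D v (n + m.+1))); last first.
  by apply/polyP => i; rewrite !coef_poly addSnnS.
rewrite /= evB (evM N S) (evM N (_ * dexp S)) (evM N m.+1%:R).
rewrite -[m.+1%:R]polyC_natr evC.
rewrite -mulr_natl.
set q' := egf N (fun n => hurw D v (n + m.+1)).
set Q := egf N.+1 _; set p1 := ev N.+1 (polar m v).
set s1 := ev N.+1 S.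
set s := ev N S; set ds := ev N (dexp S).
set p := ev N (polar m v); set dp := ev N (dexp (polar m v)) => hT.
pose q := egf N (fun n => hurw D v (n + m)).
have hq : 'X^N %| s ^+ m.+1 * q - p by exact: IH.
have hQ : 'X^N %| Q - q by exact: egfS.
have hs : 'X^N %| s1^`() - ds by exact: deriv_ev.
have hp : 'X^N %| p1^`() - dp by exact: deriv_ev.
have hX k : 'X^N %| s1 ^+ k - s ^+ k by rewrite -!evX evS.
(* The differentiated hypothesis times [s], followed by corrections from order [N.+1] to order [N]
   and one use of the hypothesis at [N]. *)
have -> : s ^+ m.+2 * q' - (s * dp - m.+1%:R * ds * p)
  = s * (m.+1%:R * (s1^`() * s1 ^+ m) * Q + s1 ^+ m.+1 * q' - p1^`())
    + s * (p1^`() - dp) - (s * q') * (s1 ^+ m.+1 - s ^+ m.+1)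
    - (m.+1%:R * ds) * (s ^+ m.+1 * q - p)
    - (s * m.+1%:R * s1 ^+ m * Q) * (s1^`() - ds)
    - (s * m.+1%:R * ds * Q) * (s1 ^+ m - s ^+ m)
    - (s * m.+1%:R * ds * s ^+ m) * (Q - q).
  by rewrite !exprS; ring.
by do ?[apply: dvdp_sub | apply: dvdp_add]; apply: dvdp_mull.
Qed.

(** Modulo [w^D - 1], [S] vanishes and [dexp S] is [D z], so each step multiplies the residue by
    [-(m+1) D z]. The same [K] serves all [v]. *)
Lemma polar_modS m : exists2 K : rat, K != 0 & forall v, exists H,
  polar m v = K%:P%:P * 'X%:P ^+ m.+1 * 'X^v + ('X^D - 1) * H.
Proof.
elim: m => [|m [K K0 IH]].
  exists D%:R => // v; exists (- 1).
  by rewrite !polyC_natr /=; ring.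
exists (- (m.+1%:R * D%:R * K)).
  by rewrite oppr_eq0 !mulf_neq0// pnatr_eq0.
move=> v; have [H defN] := IH v.
exists ('X%:P * dexp (polar m v) - m.+1%:R * (1 + D%:R * 'X%:P) * polar m v
        - m.+1%:R * D%:R * 'X%:P * H).
rewrite /= dexp_S /S.
have -> : (- (m.+1%:R * D%:R * K))%:P%:P
        = - (m.+1%:R * D%:R * K%:P%:P) :> {poly {poly rat}}.
  by rewrite !rmorphN !rmorphM !rmorph_nat.
move: (dexp (polar m v)) (polar m v) defN => dN p /eqP.
rewrite -subr_eq0 => /eqP defN.
apply/eqP; rewrite -subr_eq0; apply/eqP.
rewrite -[RHS](mulr0 (- (m.+1%:R * D%:R * 'X%:P))) -defN.
by rewrite [_ ^+ m.+2]exprS; ring.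
Qed.

(** * Linear independence of the columns *)

Lemma hurw_independent r (mu : nat -> nat -> rat) a :
    (forall n, (a <= n)%N ->
       \sum_(m < r) \sum_(v < D) mu m v * hurw D v.+1 (n + m) = 0) ->
  forall m v, (m < r)%N -> (v < D)%N -> mu m v = 0.
Proof.
elim: r => // r IH rel.
suff mu_r w : (w < D)%N -> mu r w = 0.
  move=> m v; rewrite ltnS leq_eqVlt => /predU1P[->|mr] vD; first exact: mu_r.
  apply: IH mr vD => n /rel; rewrite big_ord_recr /= [X in _ + X]big1 ?addr0//.
  by move=> i _; rewrite mu_r ?mul0r.
pose u n := \sum_(m < r.+1) \sum_(v < D) mu m v * hurw D v.+1 (n + m).
(* [u] vanishes from [a] on, so its generating function is the polynomial [c]; [Q = 0] is this
   identity cleared of denominators by [S ^+ r.+1]. *)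
pose c := egf a u.
pose Q := \sum_(m < r.+1) \sum_(v < D)
    (mu m v)%:P%:P * (S ^+ (r - m) * polar m v.+1) - c%:P * S ^+ r.+1.
have Q0 : Q = 0.
  apply: ev_inj => N; rewrite evB evM evC evX.
  have hc : 'X^N %| egf N u - c.
    apply/dvdXnP => i iN; rewrite coefB coef_egf// coef_poly.
    by case: ltnP => [_|ai]; rewrite ?subrr// /u rel// mul0r subr0.
  have hu : egf N u = \sum_(m < r.+1) \sum_(v < D)
      (mu m v)%:P * egf N (fun n => hurw D v.+1 (n + m)).
    apply/polyP => i; rewrite coef_sum coef_poly; case: ltnP => iN.
      rewrite /u mulr_suml; apply: eq_bigr => m _.
      rewrite mulr_suml coef_sum; apply: eq_bigr => v _.
      by rewrite coefCM coef_egf// -mulrA.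
    rewrite big1// => m _; rewrite coef_sum big1// => v _.
    by rewrite coefCM coef_poly ltnNge iN mulr0.
  set s := ev N S.
  have hQ : 'X^N %| s ^+ r.+1 * egf N u - ev N (\sum_(m < r.+1) \sum_(v < D)
      (mu m v)%:P%:P * (S ^+ (r - m) * polar m v.+1)).
    rewrite hu /ev horner_sum mulr_sumr -sumrB.
    apply: (big_ind (fun p => 'X^N %| p)) => [|p q|m _]; first exact: dvdp0.
      exact: dvdp_add.
    rewrite horner_sum mulr_sumr -sumrB.
    apply: (big_ind (fun p => 'X^N %| p)) => [|p q|v _]; first exact: dvdp0.
      exact: dvdp_add.
    rewrite -/(ev N _) evM evC evM evX -/s.
    have -> : s ^+ r.+1 = s ^+ (r - m) * s ^+ m.+1.
      by rewrite -exprD addnS subnK// -ltnS.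
    set h := egf N _; set p := ev N _.
    have -> : s ^+ (r - m) * s ^+ m.+1 * ((mu m v)%:P * h)
              - (mu m v)%:P * (s ^+ (r - m) * p)
            = (mu m v)%:P * s ^+ (r - m) * (s ^+ m.+1 * h - p) by ring.
    exact/dvdp_mull/polarP.
  set q := ev N _ in hQ *.
  have -> : q - c * s ^+ r.+1
          = s ^+ r.+1 * (egf N u - c) - (s ^+ r.+1 * egf N u - q) by ring.
  by apply: dvdp_sub => //; exact: dvdp_mull.
have [K K0 polarE] := polar_modS r.
(* At [z = 1] and modulo [w^D - 1], only the terms with the highest pole
   survive. *)
pose phi : {rmorphism {poly {poly rat}} -> {poly rat}} :=
  map_poly (horner_eval (1 : rat)).
have phiX : phi 'X = 'X by exact: map_polyX.
have phiC d : phi d%:P = d.[1]%:P by exact: map_polyC.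
have phiS : phi S = 'X^D - 1.
  by rewrite rmorphM rmorphB rmorph1 rmorphXn phiX phiC hornerX mul1r.
set U := \poly_(v < D) mu r v.
have : 'X^D - 1 %| K *: ('X * U).
  rewrite -(dvdp_addr (m := phi (Q + c%:P * S ^+ r.+1) - K *: ('X * U))).
    rewrite Q0 add0r rmorphM rmorphXn phiS addrNK exprS.
    by rewrite dvdp_mull// dvdp_mulr.
  rewrite subrK big_ord_recr /= rmorphD/=.
  rewrite -addrA dvdp_add//.
    rewrite rmorph_sum; apply: (big_ind (fun p => _ %| p)) => [|p q|m _].
    - exact: dvdp0.
    - exact: dvdp_add.
    rewrite rmorph_sum; apply: (big_ind (fun p => _ %| p)) => [|p q|v _].
    - exact: dvdp0.
    - exact: dvdp_add.
    rewrite rmorphM rmorphM rmorphXn phiS.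
    by rewrite -(subnSK (ltn_ord m)) exprS -mulrA dvdp_mull ?dvdp_mulr.
  rewrite rmorph_sum /U poly_def !mulr_sumr scaler_sumr -sumrB.
  apply: (big_ind (fun p => _ %| p)) => [|p q|v _].
  - exact: dvdp0.
  - exact: dvdp_add.
  have [H ->] := polarE v.+1.
  rewrite subnn expr0 mul1r !(rmorphM, rmorphB, rmorphD, rmorphXn, rmorph1).
  rewrite !phiC /= !hornerC hornerX phiX polyC1 expr1n mulr1 mulrDr.
  rewrite -!mul_polyC exprS.
  set z := (mu r v)%:P; set k := K%:P; set h := map_poly _ H.
  have -> : z * (k * ('X * 'X^v)) + z * (('X^D - 1) * h) - k * ('X * (z * 'X^v))
     = (z * h) * ('X^D - 1) by ring.
  exact: dvdp_mull.
(* ['X] is coprime to ['X^D - 1], which therefore divides [U], of degree below [D]. *)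
rewrite dvdpZr// Gauss_dvdpr; last first.
  have := coprimep_XsubC ('X^D - 1 : {poly rat}) 0; rewrite subr0 => ->.
  by rewrite /root !hornerE expr0n gtn_eqF// sub0r oppr_eq0 oner_eq0.
have sD : size ('X^D - 1 : {poly rat}) = D.+1 by rewrite size_XnsubC.
move=> dvdU wD.
have : U = 0.
  apply/eqP/negPn/negP => U0; have := dvdp_leq U0 dvdU.
  by rewrite sD ltnNge size_poly.
by move/polyP/(_ w); rewrite coef_poly wD coef0.
Qed.

End Hurwitz.

(** * Choice of the rows *)

(** Greedy choice: if all late rows lay in the span of the [k < n] rows of [A], they would kill the
    columns of [cokermx A]; these would vanish and [A] would have rank [n]. *)
Lemma increasing_row_free (F : fieldType) n (f : nat -> 'rV[F]_n) a :
    (forall b (y : 'cV_n), (forall t, (b <= t)%N -> f t *m y = 0) -> y = 0) ->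
  exists s : nat -> nat, [/\ forall i j, (i < j)%N -> (s i < s j)%N,
    forall i, (a <= s i)%N & row_free (\matrix_(i < n) f (s i))].
Proof.
move=> indep.
suff rank k : (k <= n)%N ->
    exists s : nat -> nat, [/\ forall i j, (i < j)%N -> (s i < s j)%N,
      forall i, (a <= s i)%N & (k <= \rank (\matrix_(i < k) f (s i)))%N].
  have [s [s_inc s_ge s_rank]] := rank n (leqnn n); exists s; split=> //.
  by rewrite /row_free eqn_leq rank_leq_row.
elim: k => [_|k IH kn].
  by exists (addn a); split=> // [i j|i]; rewrite ?ltn_add2l ?leq_addr.
have [s [s_inc s_ge]] := IH (ltnW kn); set A := \matrix_i _ => A_rank.
have [t [st ft]] : exists t, (s k <= t)%N /\ ~~ (f t <= A)%MS.
  apply: NNPP => no_t.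
  suff : cokermx A == 0.
    rewrite cokermx_eq0 /row_full => /eqP rA.
    by have := rank_leq_row A; rewrite rA leqNgt kn.
  apply/eqP/matrixP => i j; rewrite [RHS]mxE.
  have /colP/(_ i) : col j (cokermx A) = 0; last by rewrite !mxE.
  apply: (indep (s k)) => t st.
  have : (f t <= A)%MS by apply: contraPT no_t => ft; case; exists t.
  by rewrite submxE => /eqP ftA; rewrite colE mulmxA ftA mul0mx.
(* Beyond the new row [t] the sequence continues with [t + 1], [t + 2], and so on, to stay
   increasing on all of [nat]. *)
exists (fun i => if (i < k)%N then s i else (t + (i - k))%N); split.
- move=> i j ij; case: (ltnP j k) => jk.
    by rewrite (ltn_trans ij jk) s_inc.
  case: (ltnP i k) => ik; last first.
    by rewrite ltn_add2l ltn_sub2r// (leq_ltn_trans ik).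
  by rewrite (leq_trans (s_inc _ _ ik))// (leq_trans st)// leq_addr.
- move=> i; case: ifP => // _; rewrite (leq_trans (s_ge k))//.
  by rewrite (leq_trans st) ?leq_addr.
set A' := \matrix_i _.
have AA' : (A <= A')%MS.
  apply/row_subP => i.
  have -> : row i A = row (widen_ord (leqnSn k) i) A'.
    by rewrite !rowK /= ltn_ord.
  exact: row_sub.
apply: (leq_ltn_trans A_rank); apply: rank_ltmx; rewrite ltmxE AA' /=.
apply: contra ft; apply: submx_trans.
have -> : f t = row ord_max A' by rewrite rowK /= ltnn subnn addn0.
exact: row_sub.
Qed.

(** * Nonvanishing of the determinant *)

Theorem theorem1p2 (r D : nat) :
  (1 <= r)%N -> (D = 1%N \/ prime D) ->
  exists alpha : 'I_(r * D) -> nat,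
    (forall i j : 'I_(r * D), (i < j)%N -> (alpha i < alpha j)%N) /\
    (forall i : 'I_(r * D), (2 <= alpha i)%N) /\
    Delta r D alpha != 0.
Proof.
move=> _ D_prime.
have D0 : (0 < D)%N by case: D_prime => [->|/prime_gt0].
pose f t : 'rV[rat]_(r * D) := \row_c
  (D%:R ^+ t * bernoulli_poly (t + c %/ D) ((c %% D).+1%:R / D%:R)
   / (t + c %/ D)%:R).
have indep b (y : 'cV_(r * D)) :
    (forall t, (b <= t)%N -> f t *m y = 0) -> y = 0.
  move=> fy0.
  (* [Y] extends [y] by zero to all naturals; [D%:R ^- m] in [mu] offsets the surplus power of [D]
     in [hurw]. *)
  pose Y i : rat := oapp (y^~ 0) 0 (insub i).
  pose mu m v := D%:R ^- m * Y (m * D + v)%N.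
  have mu0 : forall m v, (m < r)%N -> (v < D)%N -> mu m v = 0.
    apply: (hurw_independent D0 (a := b)) => n bn.
    have /matrixP/(_ 0 0) := fy0 n.+1 (leqW bn); rewrite !mxE => fy.
    rewrite -[RHS]fy.
    pose G i := D%:R ^+ n.+1 *
       bernoulli_poly (n.+1 + i %/ D) ((i %% D).+1%:R / D%:R)
       / (n.+1 + i %/ D)%:R * Y i.
    (* The column index is split as [m * D + v] with [v] counted from 0, and the row is
       [alpha = n.+1]. *)
    transitivity (\sum_(0 <= i < r * D) G i).
      rewrite big_nat_mul big_mkord; apply: eq_bigr => m _.
      rewrite -{1}[(m * D)%N]add0n big_addn mulSn addnK big_mkord.
      apply: eq_bigr => v _; rewrite /G /mu /hurw [(v + m * D)%N]addnC.
      rewrite divnMDl// modnMDl.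
      rewrite divn_small// modn_small// addn0 -addSn exprD; field.
      rewrite nat1r -natrD addSn pnatr_eq0 /=.
      by rewrite expf_neq0// pnatr_eq0 -lt0n.
    rewrite big_mkord; apply: eq_bigr => c _.
    by rewrite /G /Y valK !mxE.
  apply/matrixP => c j; rewrite (ord1 j) mxE.
  have cr : (c %/ D < r)%N by rewrite ltn_divLR.
  have := mu0 _ _ cr (ltn_pmod c D0); rewrite /mu -divn_eq /Y valK /= => /eqP.
  by rewrite mulf_eq0 invr_eq0 expf_eq0 pnatr_eq0 (gtn_eqF D0) andbF => /eqP.
have [s [s_inc s_ge s_free]] := increasing_row_free 2 indep.
exists (fun i => s i); split=> [i j ij|]; first exact: s_inc.
split=> [i|]; first exact: s_ge.
rewrite -unitfE -unitmxE -row_free_unit.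
rewrite [Delta_matrix _ _ _](_ : _ = \matrix_(i < r * D) f (s i))//.
by apply/matrixP => i c; rewrite !mxE.
Qed.
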